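(* Let $L>0$, $\varepsilon\in(0,1)$, $f(\Phi)=\varepsilon\Phi-\Phi^3$ (so $f$ is continuously differentiable), and let the discrete mobility be either $M_h=-I$ (Swift-Hohenberg case) or $M_h=\Delta_h$ (phase field crystal case). Let $s\ge 1$ and let $D(z)=[d_{ij}(z)]_{i,j=1}^s$ be real lower triangular matrices ($d_{ij}=0$ for $i<j$) defined for $z\le 0$. Assume that $D(z)$ is positive definite, i.e. its symmetric part $\mathcal S[D(z)]=(D(z)+D(z)^T)/2$ is positive definite, with a uniform bound: there is a finite constant $\lambda_{\mathrm{es}}>0$, independent of $z$, such that $\lambda_{\min}\big(\mathcal S[D(z)]\big)\ge\lambda_{\mathrm{es}}$ for all $z\le0$. Then for every $K\in\mathbb R$ there exist a constant $c_f>0$ and, for every stabilization parameter $\kappa\ge c_f$, a constant $\tau_0>0$ (which may depend on $\kappa$), both independent of the spatial length $h$ and of the time-step size, such that the following holds for every even positive integer $M$ (with $h=L/M$), every initial grid function $\phi^0\in\mathbb V_h$ with $E[\phi^0]\le K$, and every time-step size $0<\tau\le\tau_0$. Let the grid functions $u^{n,i}\in\mathbb V_h$ ($n\ge1$, $1\le i\le s+1$) satisfy $u^{1,1}=\phi^0$, $u^{n+1,1}=u^{n,s+1}$ and $$\frac1\tau\sum_{j=1}^i d_{ij}(\tau M_hL_\kappa)\,\delta_\tau u^{n,j+1}=M_h\Big[L_\kappa u^{n,i+\frac12}-f_\kappa(u^{n,i})\Big],\qquad n\ge1,\ 1\le i\le s,$$ where $\delta_\tau u^{n,j+1}:=u^{n,j+1}-u^{n,j}$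 and $u^{n,i+\frac12}:=(u^{n,i+1}+u^{n,i})/2$. Then the scheme preserves the original energy dissipation law, in the form $$E[u^{n,k+1}]-E[u^{n,1}]\le\frac1\tau\sum_{i=1}^k\Big\langle M_h^{-1}\delta_\tau u^{n,i+1},\sum_{j=1}^i d_{ij}(\tau M_hL_\kappa)\,\delta_\tau u^{n,j+1}\Big\rangle\qquad\text{for } n\ge1,\ 1\le k\le s.$$ Moreover, $$\|(I+\Delta_h)u^{n,i}\|+\|u^{n,i}\|\le c_0:=\sqrt{4E[\phi^0]+\|1+\varepsilon\|^2}\qquad\text{for } n\ge1,\ 1\le i\le s,$$ where $\|1+\varepsilon\|^2=(1+\varepsilon)^2L^2$ is the squared discrete $L^2$ norm of the constant grid function $1+\varepsilon$.
   Context: Spatial discretization (Fourier pseudo-spectral): $\Omega=(0,L)^2$, $h=L/M$ with $M$ an even positive integer, $\Omega_h=\{(mh,nh):1\le m,n\le M\}$, and $\mathbb V_h$ is the space of real $L$-periodic grid functions. With $\nu=2\pi/L$ and $e_{m,n}(\mathbf x)=e^{\mathrm i\nu(mx+ny)}$, each $v\in\mathbb V_h$ is written uniquely on the grid as $v_h=\sum_{m,n=-M/2}^{M/2-1}\tilde v_{m,n}e_{m,n}(\mathbf x_h)$, and the discrete Laplacian is $\Delta_hv_h=\sum_{m,n=-M/2}^{M/2-1}-\nu^2(m^2+n^2)\tilde v_{m,n}e_{m,n}(\mathbf x_h)$. The discrete inner product is $\langle v,w\rangle=h^2\sum_{\mathbf x_h\in\Omega_h}v_hw_h$, with norm $\|v\|=\sqrt{\langle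 v,v\rangle}$. Operators: $L_\kappa=(I+\Delta_h)^2+\kappa I$ and $f_\kappa(v)=\kappa v+f(v)$ (pointwise). The matrix functions $d_{ij}(\tau M_hL_\kappa)$ are defined through the spectrum of the symmetric negative semi-definite operator $\tau M_hL_\kappa$ (which is diagonal in the discrete Fourier basis). If $M_h=-I$, then $M_h^{-1}=-I$. If $M_h=\Delta_h$, then $M_h^{-1}$ is defined on grid functions with $\langle v,1\rangle=0$ (the stage differences $\delta_\tau u^{n,i+1}$ are of this type) by $M_h^{-1}v_h=-\sum_{(m,n)\ne(0,0)}\big(\nu^2(m^2+n^2)\big)^{-1}\tilde v_{m,n}e_{m,n}(\mathbf x_h)$. Discrete energy: $E[v]=\tfrac12\langle v,(I+\Delta_h)^2v\rangle+\langle F(v),1\rangle$ with $F(\Phi)=\tfrac14\Phi^4-\tfrac\varepsilon2\Phi^2$, so $f=-F'$. The scheme is the unified differential form of $s$-stage Runge-Kutta methods for the model $\partial_t\Phi=\mathcal M[(I+\Delta)^2\Phi-f(\Phi)]$, with $\mathcal M=-I$ or $\mathcal M=\Delta$. *)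

(* Defs.v *)
From HB Require Import structures.
From mathcomp Require Import all_boot all_order all_algebra.
From mathcomp Require Import all_classical all_reals all_analysis.
From mathcomp Require Import complex ring lra zify.

Set Implicit Arguments.
Unset Strict Implicit.
Unset Printing Implicit Defensive.

Import Order.TTheory GRing.Theory Num.Theory.
Import numFieldNormedType.Exports.

Local Open Scope ring_scope.
Local Open Scope complex_scope.

(* A real L-periodic grid function is determined by its values on
   Omega_h = {(m h, n h) : 1 <= m, n <= M}.  The entry (a, b) of v : 'M[R]_M is
   the value of v at the point (a.+1 * h, b.+1 * h).  The ring product of
   'M[R]_M is never used; pointwise operations go through map_mx. *)

Definition hstep (R : realType) (L : R) (M : nat) : R := L / M%:R.

Definition gcoord (R : realType) (L : R) (M : nat) (a : 'I_M) : R :=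
  a.+1%:R * hstep L M.

Definition nu (R : realType) (L : R) : R := 2 * pi / L.

Definition cexpi (R : realType) (t : R) : R[i] := cos t +i* sin t.

Definition fmode (R : realType) (L : R) (m n : int) (x y : R) : R[i] :=
  cexpi (nu L * (m%:~R * x + n%:~R * y)).

(* The k-th element of -M/2, ..., M/2 - 1. *)
Definition freq (M : nat) (k : 'I_M) : int := (k : nat)%:Z - (M./2)%:Z.

(* The coefficient of v on the mode (freq p, freq q).  That these are the unique
   coefficients of the expansion of v on the grid is proved in [dft_expansion]
   and [dft_unique]. *)
Definition dft (R : realType) (L : R) (M : nat) (v : 'M[R]_M) (p q : 'I_M) :
    R[i] :=
  (M%:R ^+ 2)^-1 *
  \sum_(a < M) \sum_(b < M)
    (v a b)%:C * (fmode L (freq p) (freq q) (gcoord L a) (gcoord L b))^*%C.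

Definition fsynth (R : realType) (L : R) (M : nat) (c : 'I_M -> 'I_M -> R[i])
    (a b : 'I_M) : R[i] :=
  \sum_(p < M) \sum_(q < M)
    c p q * fmode L (freq p) (freq q) (gcoord L a) (gcoord L b).

(* The operator with eigenvalue sg m n on the mode (m, n).  All symbols used
   below are even in m and in n and M is even, and then the synthesized function
   is already real, so that Re loses nothing: see [fmultE]. *)
Definition fmult (R : realType) (L : R) (M : nat) (sg : int -> int -> R)
    (v : 'M[R]_M) : 'M[R]_M :=
  \matrix_(a, b)
    complex.Re
      (fsynth L (fun p q => (sg (freq p) (freq q))%:C * dft L v p q) a b).

Definition lap_sym (R : realType) (L : R) (m n : int) : R :=
  - (nu L ^+ 2 * (m%:~R ^+ 2 + n%:~R ^+ 2)).

Definition lap (R : realType) (L : R) (M : nat) (v : 'M[R]_M) : 'M[R]_M :=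
  fmult L (lap_sym L) v.

Definition Ilap (R : realType) (L : R) (M : nat) (v : 'M[R]_M) : 'M[R]_M :=
  v + lap L v.

Definition Lkap (R : realType) (L kap : R) (M : nat) (v : 'M[R]_M) : 'M[R]_M :=
  Ilap L (Ilap L v) + kap *: v.

(* SH : mobility -I (Swift-Hohenberg); PFC : mobility Delta_h (phase field
   crystal). *)
Inductive mobility := SH | PFC.

Definition Mh (R : realType) (L : R) (mob : mobility) (M : nat)
    (v : 'M[R]_M) : 'M[R]_M :=
  match mob with SH => - v | PFC => lap L v end.

(* For PFC this is the inverse of Delta_h on grid functions with zero mean; the
   formula is extended to all grid functions by dropping the mode (0, 0). *)
Definition Mhinv (R : realType) (L : R) (mob : mobility) (M : nat)
    (v : 'M[R]_M) : 'M[R]_M :=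
  match mob with
  | SH => - v
  | PFC => fmult L (fun m n =>
      if (m == 0) && (n == 0) then 0
      else - (nu L ^+ 2 * (m%:~R ^+ 2 + n%:~R ^+ 2))^-1) v
  end.

Definition Mh_sym (R : realType) (L : R) (mob : mobility) (m n : int) : R :=
  match mob with SH => -1 | PFC => lap_sym L m n end.

Definition Lkap_sym (R : realType) (L kap : R) (m n : int) : R :=
  (1 + lap_sym L m n) ^+ 2 + kap.

(* g (tau M_h L_kappa), defined through the spectrum: tau M_h L_kappa has
   eigenvalue tau * Mh_sym * Lkap_sym on each mode, see [Mh_LkapE]. *)
Definition funML (R : realType) (L kap tau : R) (mob : mobility) (M : nat)
    (g : R -> R) (v : 'M[R]_M) : 'M[R]_M :=
  fmult L (fun m n => g (tau * (Mh_sym L mob m n * Lkap_sym L kap m n))) v.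

Definition hinner (R : realType) (L : R) (M : nat) (v w : 'M[R]_M) : R :=
  hstep L M ^+ 2 * \sum_(a < M) \sum_(b < M) v a b * w a b.

Definition hnorm (R : realType) (L : R) (M : nat) (v : 'M[R]_M) : R :=
  Num.sqrt (hinner L v v).

Definition ff (R : realType) (eps x : R) : R := eps * x - x ^+ 3.

Definition FF (R : realType) (eps x : R) : R :=
  4^-1 * x ^+ 4 - eps / 2 * x ^+ 2.

Definition fkap (R : realType) (eps kap x : R) : R := kap * x + ff eps x.

Definition energy (R : realType) (L eps : R) (M : nat) (v : 'M[R]_M) : R :=
  2^-1 * hinner L v (Ilap L (Ilap L v))
  + hinner L (map_mx (FF eps) v) (const_mx 1).

Definition sympart (R : realType) (s : nat) (A : 'M[R]_s) : 'M[R]_s :=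
  2^-1 *: (A + A^T).

Definition posdef (R : realType) (s : nat) (A : 'M[R]_s) : Prop :=
  forall x : 'cV[R]_s, x != 0 -> 0 < (x^T *m A *m x) 0 0.

(* Only meaningful for matrices with a real eigenvalue, such as symmetric
   matrices of positive size; the infimum is then a minimum. *)
Definition lambda_min (R : realType) (s : nat) (A : 'M[R]_s) : R :=
  inf [set a : R | eigenvalue A a]%classic.

(* Stages are numbered from 1 as u n 1, ..., u n s.+1, while matrix indices
   j : 'I_s start at 0: the index j stands for the stage j.+1, and
   u n j.+2 - u n j.+1 for delta_tau u^{n,(j+1)+1}. *)
Definition dtau (R : realType) (M : nat) (u : nat -> nat -> 'M[R]_M)
    (n i : nat) : 'M[R]_M :=
  u n i - u n i.-1.

(* sum_{j=1}^i d_ij(tau M_h L_kappa) delta_tau u^{n,j+1} *)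
Definition dsum (R : realType) (L kap tau : R) (mob : mobility) (s : nat)
    (D : R -> 'M[R]_s) (M : nat) (u : nat -> nat -> 'M[R]_M) (n : nat)
    (i : 'I_s) : 'M[R]_M :=
  \sum_(j < s | (j <= i)%N)
    funML L kap tau mob (fun z => D z i j) (dtau u n j.+2).

Definition is_RK_solution (R : realType) (L eps kap tau : R) (mob : mobility)
    (s : nat) (D : R -> 'M[R]_s) (M : nat) (phi0 : 'M[R]_M)
    (u : nat -> nat -> 'M[R]_M) : Prop :=
  [/\ u 1%N 1%N = phi0,
      (forall n : nat, (1 <= n)%N -> u n.+1 1%N = u n s.+1)
    & forall (n : nat) (i : 'I_s), (1 <= n)%N ->
        tau^-1 *: dsum L kap tau mob D u n i =
        Mh L mob (Lkap L kap (2^-1 *: (u n i.+2 + u n i.+1))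
                  - map_mx (fkap eps kap) (u n i.+1))].

#[local] Arguments conjc : simpl never.
#[local] Arguments cexpi : simpl never.

Lemma cexpi0 (R : realType) : cexpi (0 : R) = 1.
Proof. by rewrite /cexpi cos0 sin0. Qed.

Lemma cexpiD (R : realType) (x y : R) : cexpi (x + y) = cexpi x * cexpi y.
Proof.
apply/eqP; rewrite /cexpi sinD cosD eq_complex /=.
by rewrite eqxx /= addrC.
Qed.

Lemma cexpiN (R : realType) (x : R) : cexpi (- x) = (cexpi x)^*%C.
Proof. by rewrite /cexpi cosN sinN. Qed.

Lemma cexpiMn (R : realType) (x : R) (n : nat) :
  cexpi (x * n%:R) = cexpi x ^+ n.
Proof.
elim: n => [|n IH]; first by rewrite mulr0 cexpi0 expr0.
by rewrite -natr1 mulrDr mulr1 cexpiD IH exprSr.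
Qed.

Lemma cexpi_2pi_int (R : realType) (k : int) :
  cexpi (2 * pi * k%:~R : R) = 1.
Proof.
have E n : cexpi (2 * pi * n%:R : R) = 1.
  rewrite cexpiMn (_ : cexpi _ = 1) ?expr1n //.
  rewrite mulr_natl /cexpi cos2pi sin2pi //.
case: k => n; first exact: E.
by rewrite NegzE rmorphN /= mulrN cexpiN E conjc1.
Qed.

Lemma cexpi_neq1 (R : realType) (x : R) :
  x != 0 -> `|x| < 2 * pi -> cexpi x != 1.
Proof.
move=> x0 xlt; apply/eqP => /(congr1 (@complex.Re R)) /= c1.
have h : 0 < sin (`|x| / 2).
  apply: sin_gt0_pi; rewrite divr_gt0 ?normr_gt0 //=.
  by rewrite ltr_pdivrMr // mulrC.
have := cos_mulr2n (`|x| / 2).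
rewrite (_ : `|x| / 2 *+ 2 = `|x|); last by rewrite -mulr_natr divfK ?pnatr_eq0.
rewrite cos_norm c1 cos2sin2 => e.
have : sin (`|x| / 2) ^+ 2 = 0 by lra.
by move/eqP; rewrite expf_eq0 /= gt_eqF.
Qed.

(* Orthogonality of the one-dimensional discrete modes, in a form used both for
   sums over grid points and for sums over frequencies. *)
Lemma sum_wave (R : realType) (M : nat) (d : int) (c : R) :
  (0 < M)%N -> (`|d| < M%:Z)%R ->
  \sum_(a < M) cexpi (2 * pi / M%:R * d%:~R * (a%:R + c)) =
  if d == 0 then M%:R else 0.
Proof.
move=> M0 dM.
have MR0 : (M%:R : R) != 0 by rewrite pnatr_eq0 -lt0n.
case: eqVneq => [->|d0].
  rewrite (eq_bigr (fun=> 1)); first by rewrite sumr_const card_ord.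
  by move=> a _; rewrite mulr0 mul0r cexpi0.
set t := 2 * pi / M%:R * d%:~R.
have z1 : cexpi t != 1.
  apply: cexpi_neq1.
    rewrite /t !mulf_neq0 ?invr_neq0 ?MR0 ?intr_eq0 ?pnatr_eq0 //.
    by rewrite gt_eqF // pi_gt0.
  rewrite /t !normrM (gtr0_norm (pi_gt0 R)) ger0_norm ?ler0n // ger0_norm //.
  rewrite -mulrA gtr_pMr ?mulr_gt0 ?pi_gt0 // mulrC ltr_pdivrMr ?ltr0n //.
  by rewrite mul1r -intr_norm -[M%:R]/((M%:Z)%:~R) ltr_int.
rewrite (eq_bigr (fun a : 'I_M => cexpi (t * c) * cexpi t ^+ a)); last first.
  by move=> a _; rewrite mulrDr cexpiD cexpiMn mulrC.
rewrite -big_distrr /=.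
have := subrX1 (cexpi t) M.
rewrite -cexpiMn (_ : t * M%:R = 2 * pi * d%:~R) ?cexpi_2pi_int; last first.
  by rewrite /t mulrAC divfK.
rewrite subrr => /esym/eqP; rewrite mulf_eq0 subr_eq0 (negPf z1) /=.
by move=> /eqP ->; rewrite mulr0.
Qed.

Definition wave (R : realType) (M : nat) (m : int) (a : 'I_M) : R[i] :=
  cexpi (2 * pi / M%:R * m%:~R * a.+1%:R).

Lemma fmode_grid (R : realType) (L : R) (M : nat) (m n : int) (a b : 'I_M) :
  0 < L -> fmode L m n (gcoord L a) (gcoord L b) = wave R m a * wave R n b.
Proof.
move=> L0; rewrite /fmode /wave -cexpiD; congr cexpi.
have MR0 : (M%:R : R) != 0 by rewrite pnatr_eq0 -lt0n (leq_trans _ (ltn_ord a)).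
have L00 : L != 0 by rewrite gt_eqF.
by rewrite /nu /gcoord /hstep; field; rewrite MR0 L00.
Qed.

Lemma ord_subr_lt (M : nat) (p q : 'I_M) : (`|(p : nat)%:Z - (q : nat)%:Z| < M%:Z)%R.
Proof. have := ltn_ord p; have := ltn_ord q; lia. Qed.

Lemma sum_wave_grid (R : realType) (M : nat) (p q : 'I_M) :
  \sum_(a < M) wave R (freq p) a * (wave R (freq q) a)^*%C =
  if p == q then M%:R else 0.
Proof.
have M0 : (0 < M)%N by apply: leq_trans (ltn_ord p).
have := sum_wave (1 : R) M0 (ord_subr_lt p q).
rewrite subr_eq0 eqz_nat (inj_eq val_inj) => <-.
apply: eq_bigr => a _; rewrite /wave -cexpiN -cexpiD; congr cexpi.
rewrite /freq !rmorphB /= -!natr1; ring.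
Qed.

Lemma sum_wave_freq (R : realType) (M : nat) (a b : 'I_M) :
  \sum_(p < M) wave R (freq p) a * (wave R (freq p) b)^*%C =
  if a == b then M%:R else 0.
Proof.
have M0 : (0 < M)%N by apply: leq_trans (ltn_ord a).
have := sum_wave (- (M./2)%:R : R) M0 (ord_subr_lt a b).
rewrite subr_eq0 eqz_nat (inj_eq val_inj) => <-.
apply: eq_bigr => p _; rewrite /wave -cexpiN -cexpiD; congr cexpi.
rewrite /freq !rmorphB /= -!natr1; ring.
Qed.

Lemma conjcM (R : realType) (x y : R[i]) : (x * y)^*%C = x^*%C * y^*%C.
Proof. exact: (rmorphM (@conjc R)). Qed.

Lemma dft_expansion (R : realType) (L : R) (M : nat) (v : 'M[R]_M)
    (a b : 'I_M) :
  0 < L -> (v a b)%:C = fsynth L (dft L v) a b.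
Proof.
move=> L0; rewrite /fsynth /dft.
have M0 : (0 < M)%N by apply: leq_trans (ltn_ord a).
have MC0 : (M%:R : R[i]) != 0 by rewrite pnatr_eq0 -lt0n.
pose K (a' b' : 'I_M) : R[i] :=
  (\sum_(p < M) wave R (freq p) a * (wave R (freq p) a')^*%C) *
  (\sum_(q < M) wave R (freq q) b * (wave R (freq q) b')^*%C).
transitivity ((M%:R ^+ 2)^-1 *
    \sum_(a' < M) \sum_(b' < M) (v a' b')%:C * K a' b'); last first.
  rewrite big_distrr /=.
  under eq_bigr => a' _ do rewrite big_distrr /=.
  under [RHS]eq_bigr => p _ do under eq_bigr => q _ do
    (rewrite big_distrr big_distrl /=;
     under eq_bigr => a' _ do rewrite big_distrr big_distrl /=).
  under [RHS]eq_bigr => p _ do rewrite exchange_big /=.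
  rewrite [RHS]exchange_big /=; apply: eq_bigr => a' _.
  under [RHS]eq_bigr => p _ do rewrite exchange_big /=.
  rewrite [RHS]exchange_big /=; apply: eq_bigr => b' _.
  rewrite /K big_distrl /= !big_distrr /=; apply: eq_bigr => p _.
  rewrite !big_distrr /=; apply: eq_bigr => q _.
  by rewrite !fmode_grid // conjcM; ring.
rewrite (bigD1 a) //= (bigD1 b) //= {1}/K !sum_wave_freq !eqxx.
rewrite !big1 ?addr0 => [|a' a'a|b' b'b].
- by field.
- rewrite big1 // => b' _.
  by rewrite /K !sum_wave_freq eq_sym (negPf a'a) mul0r mulr0.
- by rewrite /K !sum_wave_freq eqxx eq_sym (negPf b'b) !mulr0.
Qed.

Lemma dft_unique (R : realType) (L : R) (M : nat) (v : 'M[R]_M)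
    (c : 'I_M -> 'I_M -> R[i]) :
  0 < L -> (forall a b, (v a b)%:C = fsynth L c a b) ->
  forall p q, c p q = dft L v p q.
Proof.
move=> L0 vE p q; rewrite /dft.
have M0 : (0 < M)%N by apply: leq_trans (ltn_ord p).
have MC0 : (M%:R : R[i]) != 0 by rewrite pnatr_eq0 -lt0n.
under eq_bigr => a _ do under eq_bigr => b _ do rewrite vE /fsynth.
pose K (p' q' : 'I_M) : R[i] :=
  (\sum_(a < M) wave R (freq p') a * (wave R (freq p) a)^*%C) *
  (\sum_(b < M) wave R (freq q') b * (wave R (freq q) b)^*%C).
transitivity ((M%:R ^+ 2)^-1 *
    \sum_(p' < M) \sum_(q' < M) c p' q' * K p' q'); last first.
  congr (_ * _).
  under [RHS]eq_bigr => a _ do under eq_bigr => b _ do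
    (rewrite big_distrl /=; under eq_bigr => p' _ do rewrite big_distrl /=).
  under [RHS]eq_bigr => a _ do rewrite exchange_big /=.
  rewrite [RHS]exchange_big /=; apply: eq_bigr => p' _.
  under [RHS]eq_bigr => a _ do rewrite exchange_big /=.
  rewrite [RHS]exchange_big /=; apply: eq_bigr => q' _.
  rewrite /K big_distrl /= big_distrr /=; apply: eq_bigr => a _.
  rewrite !big_distrr /=; apply: eq_bigr => b _.
  by rewrite !fmode_grid // conjcM; ring.
rewrite (bigD1 p) //= (bigD1 q) //= {1}/K !sum_wave_grid !eqxx.
rewrite !big1 ?addr0 => [|p' p'p|q' q'q].
- by field.
- rewrite big1 // => q' _.
  by rewrite /K !sum_wave_grid (negPf p'p) mul0r mulr0.
- by rewrite /K !sum_wave_grid eqxx (negPf q'q) !mulr0.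
Qed.

Definition even_sym (R : realType) (sg : int -> int -> R) : Prop :=
  forall m n : int, sg (- m) n = sg m n /\ sg m (- n) = sg m n.

(* The index of minus the k-th frequency, modulo M. *)
Definition ord_neg (M : nat) (k : 'I_M) : 'I_M :=
  Ordinal (ltn_pmod (M - k) (leq_ltn_trans (leq0n k) (ltn_ord k))).

Lemma val_ord_neg (M : nat) (k : 'I_M) :
  ord_neg k = (if k == 0 :> nat then 0 else M - k)%N :> nat.
Proof.
rewrite /=; case: eqVneq => [->|k0]; first by rewrite subn0 modnn.
by rewrite modn_small //; have := ltn_ord k; lia.
Qed.

Lemma ord_negK (M : nat) : involutive (@ord_neg M).
Proof.
move=> k; apply: ord_inj; rewrite !val_ord_neg; have := ltn_ord k.
by case: (eqVneq (k : nat) 0%N) => [->|k0] //= kM; case: eqVneq => ?; lia.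
Qed.

Lemma freq_neg (M : nat) (k : 'I_M) : ~~ odd M ->
  freq (ord_neg k) = freq k \/ freq (ord_neg k) = - freq k.
Proof.
move=> eM; rewrite /freq val_ord_neg; have := ltn_ord k.
have := odd_double_half M; rewrite (negPf eM).
by case: eqVneq => k0; [left|right]; lia.
Qed.

Lemma wave_neg (R : realType) (M : nat) (k a : 'I_M) : ~~ odd M ->
  wave R (freq (ord_neg k)) a = (wave R (freq k) a)^*%C.
Proof.
move=> eM; rewrite /wave -cexpiN.
have M0 : (0 < M)%N by apply: leq_trans (ltn_ord a).
have MR0 : (M%:R : R) != 0 by rewrite pnatr_eq0 -lt0n.
have [j ->] : exists j : int, freq (ord_neg k) = M%:Z * j - freq k.
  rewrite /freq val_ord_neg; have := ltn_ord k.
  have := odd_double_half M; rewrite (negPf eM) => hM kM.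
  by case: eqVneq => k0; [exists (-1)|exists 0]; lia.
rewrite -[RHS]mul1r -(cexpi_2pi_int R (j * a.+1%:Z)) -cexpiD; congr cexpi.
by rewrite rmorphB !rmorphM /= -[(a.+1)%:~R]/(a.+1%:R); field.
Qed.

Lemma conj_sum (R : realType) (I : finType) (F : I -> R[i]) :
  (\sum_i F i)^*%C = \sum_i (F i)^*%C.
Proof. exact: (rmorph_sum (@conjc R)). Qed.

Lemma dft_neg (R : realType) (L : R) (M : nat) (v : 'M[R]_M) (p q : 'I_M) :
  0 < L -> ~~ odd M ->
  dft L v (ord_neg p) (ord_neg q) = (dft L v p q)^*%C.
Proof.
move=> L0 eM; rewrite /dft conjcM -natrX conjc_inv conjc_nat conj_sum.
congr (_ * _); apply: eq_bigr => a _.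
rewrite conj_sum; apply: eq_bigr => b _.
by rewrite conjcM conjc_real !fmode_grid // !wave_neg // -conjcM.
Qed.

Lemma fmultE (R : realType) (L : R) (M : nat) (sg : int -> int -> R)
    (v : 'M[R]_M) (a b : 'I_M) :
  0 < L -> ~~ odd M -> even_sym sg ->
  (fmult L sg v a b)%:C =
  fsynth L (fun p q => (sg (freq p) (freq q))%:C * dft L v p q) a b.
Proof.
move=> L0 eM ev; rewrite mxE; set z := fsynth _ _ a b.
suff zJ : z^*%C = z.
  apply/eqP; rewrite eq_complex /= eqxx /=; apply/eqP.
  by move: zJ; case: z => x y [] /= e; lra.
rewrite /z /fsynth conj_sum (reindex_inj (inv_inj (@ord_negK M))) /=.
apply: eq_bigr => p _.
rewrite conj_sum (reindex_inj (inv_inj (@ord_negK M))) /=.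
apply: eq_bigr => q _.
rewrite dft_neg // (conjcM (_ * _)) (conjcM _%:C) conjc_real conjcK.
rewrite !fmode_grid // conjcM.
rewrite !wave_neg // !conjcK; congr (_%:C * _ * _).
have E m n : sg (- m) n = sg m n by case: (ev m n).
have E' m n : sg m (- n) = sg m n by case: (ev m n).
by case: (freq_neg p eM) => ->; case: (freq_neg q eM) => ->; rewrite ?E ?E'.
Qed.

Lemma dft_fmult (R : realType) (L : R) (M : nat) (sg : int -> int -> R)
    (v : 'M[R]_M) (p q : 'I_M) :
  0 < L -> ~~ odd M -> even_sym sg ->
  dft L (fmult L sg v) p q = (sg (freq p) (freq q))%:C * dft L v p q.
Proof.
move=> L0 eM ev; symmetry.
by apply: (dft_unique (c := fun p q => _ * _)) => // a b; exact: fmultE.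
Qed.

Lemma fmult_comp (R : realType) (L : R) (M : nat) (sg1 sg2 : int -> int -> R)
    (v : 'M[R]_M) :
  0 < L -> ~~ odd M -> even_sym sg2 ->
  fmult L sg1 (fmult L sg2 v) = fmult L (fun m n => sg1 m n * sg2 m n) v.
Proof.
move=> L0 eM ev; apply/matrixP => a b; rewrite !mxE; congr complex.Re.
apply: eq_bigr => p _; apply: eq_bigr => q _.
by rewrite dft_fmult // rmorphM mulrA.
Qed.

Lemma fmult1 (R : realType) (L : R) (M : nat) (v : 'M[R]_M) :
  0 < L -> fmult L (fun _ _ => 1) v = v.
Proof.
move=> L0; apply/matrixP => a b; rewrite mxE.
rewrite (_ : fsynth _ _ _ _ = (v a b)%:C) // (dft_expansion v a b L0).
by apply: eq_bigr => p _; apply: eq_bigr => q _; rewrite mul1r.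
Qed.

Lemma fmultD (R : realType) (L : R) (M : nat) (sg1 sg2 : int -> int -> R)
    (v : 'M[R]_M) :
  fmult L (fun m n => sg1 m n + sg2 m n) v = fmult L sg1 v + fmult L sg2 v.
Proof.
apply/matrixP => a b; rewrite !mxE -(raddfD (@complex.Re R : Rcomplex R -> R)).
congr complex.Re; rewrite /fsynth -big_split; apply: eq_bigr => p _.
rewrite -big_split; apply: eq_bigr => q _.
by rewrite rmorphD /= !mulrDl.
Qed.

Lemma fmultZ (R : realType) (L : R) (M : nat) (sg : int -> int -> R) (c : R)
    (v : 'M[R]_M) :
  fmult L (fun m n => c * sg m n) v = c *: fmult L sg v.
Proof.
apply/matrixP => a b; rewrite !mxE.
transitivity (complex.Re (c%:C *
    fsynth L (fun p q => (sg (freq p) (freq q))%:C * dft L v p q) a b)).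
  congr complex.Re; rewrite /fsynth big_distrr; apply: eq_bigr => p _.
  rewrite big_distrr; apply: eq_bigr => q _.
  by rewrite rmorphM /= -!mulrA.
by case: fsynth => x y /=; rewrite mul0r subr0.
Qed.

Lemma lap_sym_even (R : realType) (L : R) : even_sym (lap_sym L).
Proof. by move=> m n; rewrite /lap_sym !rmorphN !sqrrN. Qed.

Lemma IlapE (R : realType) (L : R) (M : nat) (v : 'M[R]_M) :
  0 < L -> Ilap L v = fmult L (fun m n => 1 + lap_sym L m n) v.
Proof. by move=> L0; rewrite fmultD fmult1. Qed.

Lemma LkapE (R : realType) (L kap : R) (M : nat) (v : 'M[R]_M) :
  0 < L -> ~~ odd M -> Lkap L kap v = fmult L (Lkap_sym L kap) v.
Proof.
move=> L0 eM; rewrite /Lkap !IlapE // fmult_comp //; last first.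
  by move=> m n; rewrite !(lap_sym_even L m n).1 !(lap_sym_even L m n).2.
rewrite -{2}(fmult1 v L0) -fmultZ -fmultD; congr fmult.
by apply/funext => m; apply/funext => n; rewrite mulr1 -expr2.
Qed.

Lemma Mh_LkapE (R : realType) (L kap : R) (mob : mobility) (M : nat)
    (v : 'M[R]_M) :
  0 < L -> ~~ odd M ->
  Mh L mob (Lkap L kap v) =
  fmult L (fun m n => Mh_sym L mob m n * Lkap_sym L kap m n) v.
Proof.
move=> L0 eM; rewrite LkapE //; case: mob => /=.
  by rewrite fmultZ scaleN1r.
rewrite /lap fmult_comp // => m n.
by rewrite /Lkap_sym !(lap_sym_even L m n).1 !(lap_sym_even L m n).2.
Qed.

Lemma Mh_Mhinv (R : realType) (L : R) (mob : mobility) (M : nat)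
    (v : 'M[R]_M) :
  0 < L -> ~~ odd M -> hinner L v (const_mx 1) = 0 ->
  Mh L mob (Mhinv L mob v) = v.
Proof.
case: mob => /= L0 eM; first by rewrite opprK.
move=> v0; rewrite /lap fmult_comp //; last first.
  by move=> m n; rewrite !oppr_eq0 !rmorphN !sqrrN.
rewrite -[RHS](fmult1 v L0); apply/matrixP => a b; rewrite !mxE.
congr complex.Re; apply: eq_bigr => p _; apply: eq_bigr => q _.
congr (_ * _); case: ifPn => [/andP[/eqP p0 /eqP q0]|pq0]; last first.
  rewrite /lap_sym mulrNN divff // mulf_neq0 //.
    by rewrite expf_neq0 // /nu !mulf_neq0 ?invr_neq0 ?gt_eqF ?pi_gt0.
  rewrite paddr_eq0 ?sqr_ge0 // !expf_eq0 /= !intr_eq0; exact: pq0.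
suff -> : dft L v p q = 0 by rewrite !mulr0.
have M0 : (0 < M)%N by apply: leq_trans (ltn_ord a).
have : \sum_(i < M) \sum_(j < M) v i j = 0.
  move: v0; rewrite /hinner => /eqP; rewrite mulf_eq0 expf_eq0 /=.
  rewrite /hstep mulf_eq0 invr_eq0 pnatr_eq0 (gt_eqF L0) (gtn_eqF M0) /=.
  move=> /eqP e; rewrite -[RHS]e.
  by apply: eq_bigr => i _; apply: eq_bigr => j _; rewrite mxE mulr1.
move=> S0; rewrite /dft.
rewrite (_ : \sum_(i < M) _ = (\sum_(i < M) \sum_(j < M) v i j)%:C).
  by rewrite S0 mulr0.
rewrite rmorph_sum; apply: eq_bigr => i _.
rewrite rmorph_sum; apply: eq_bigr => j _.
rewrite p0 q0 /fmode !mul0r addr0 mulr0 cexpi0 conjc1 mulr1 //.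
Qed.

Lemma hnorm_const (R : realType) (L c : R) (M : nat) :
  (0 < M)%N -> hnorm L (const_mx c : 'M[R]_M) ^+ 2 = c ^+ 2 * L ^+ 2.
Proof.
move=> M0; have MR0 : (M%:R : R) != 0 by rewrite pnatr_eq0 -lt0n.
rewrite sqr_sqrtr; last first.
  rewrite mulr_ge0 ?sqr_ge0 // sumr_ge0 // => i _; rewrite sumr_ge0 // => j _.
  by rewrite mxE -expr2 sqr_ge0.
rewrite /hinner /hstep.
under eq_bigr => i _ do under eq_bigr => j _ do rewrite mxE.
rewrite !sumr_const !card_ord -(mulr_natr (c * c)) -(mulr_natr (c * c * _)).
by move: (M%:R) MR0 => m m0; field.
Qed.

(* Main.v *)
(* Write d_i for the stage differences and |.| for the discrete L^2 norm.
   Testing stage i with Mhinv d_i and summing over the first k stages, the left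
   side is nonpositive because, mode by mode, it is the quadratic form of the
   leading k x k block of D weighted by an eigenvalue of Mhinv.  On the right the
   kap-terms telescope against each other up to kap/2 |d_i|^2, which leaves
     1/2 |(I+Lap)u^{k+1}|^2 - 1/2 |(I+Lap)u^1|^2
       + sum_i (kap/2 |d_i|^2 - <d_i, f(u^i)>) <= 0.
   For kap >= 1 the term in kap absorbs <d_i, f(u^i)>, so a discrete H^2 bound
   passes from the stages 1..k to the stage k+1 with a constant that depends
   neither on kap, tau nor M, and a discrete Sobolev inequality turns it into a
   bound B for the sup norm of all stages of a step.  For kap >= 3 B^2 the
   convexity of kap x^2/2 - F(x) on [-B, B] bounds the increment of the energy by
   the sum above.  The energy thus decreases over the step, the next step starts
   from the same H^2 bound, and tau0 = 1 works. *)

Require Import Defs.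
From HB Require Import structures.
From mathcomp Require Import all_boot all_order all_algebra.
From mathcomp Require Import all_classical all_reals all_analysis.
From mathcomp Require Import complex ring lra zify.
Import Order.TTheory GRing.Theory Num.Theory.
Import numFieldNormedType.Exports.
Local Open Scope ring_scope.
Local Open Scope complex_scope.

Set Implicit Arguments.
Unset Strict Implicit.
Unset Printing Implicit Defensive.

#[local] Arguments conjc : simpl never.
#[local] Arguments cexpi : simpl never.

(** * The discrete inner product *)

Section Inner.
Variables (R : realType) (L : R).

Lemma hinnerC M (v w : 'M[R]_M) : hinner L v w = hinner L w v.
Proof.
by congr (_ * _); apply: eq_bigr => a _; apply: eq_bigr => b _; rewrite mulrC.
Qed.

Lemma hinnerDl M (u v w : 'M[R]_M) :
  hinner L (u + v) w = hinner L u w + hinner L v w.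
Proof.
rewrite /hinner -mulrDr -big_split; congr (_ * _); apply: eq_bigr => a _.
by rewrite -big_split; apply: eq_bigr => b _; rewrite mxE mulrDl.
Qed.

Lemma hinnerZl M (c : R) (v w : 'M[R]_M) :
  hinner L (c *: v) w = c * hinner L v w.
Proof.
rewrite /hinner mulrCA; congr (_ * _); rewrite big_distrr.
apply: eq_bigr => a _ /=; rewrite big_distrr.
by apply: eq_bigr => b _ /=; rewrite mxE mulrA.
Qed.

Lemma hinner0l M (w : 'M[R]_M) : hinner L 0 w = 0.
Proof. by rewrite -(scale0r (0 : 'M[R]_M)) hinnerZl mul0r. Qed.

Lemma hinnerNl M (v w : 'M[R]_M) : hinner L (- v) w = - hinner L v w.
Proof. by rewrite -scaleN1r hinnerZl mulN1r. Qed.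

Lemma hinnerDr M (u v w : 'M[R]_M) :
  hinner L u (v + w) = hinner L u v + hinner L u w.
Proof. by rewrite !(hinnerC u) hinnerDl. Qed.

Lemma hinnerZr M (c : R) (v w : 'M[R]_M) :
  hinner L v (c *: w) = c * hinner L v w.
Proof. by rewrite !(hinnerC v) hinnerZl. Qed.

Lemma hinnerNr M (v w : 'M[R]_M) : hinner L v (- w) = - hinner L v w.
Proof. by rewrite !(hinnerC v) hinnerNl. Qed.

Lemma hinner_suml M (I : Type) (r : seq I) (P : pred I) (F : I -> 'M[R]_M)
    (w : 'M[R]_M) :
  hinner L (\sum_(i <- r | P i) F i) w = \sum_(i <- r | P i) hinner L (F i) w.
Proof.
by apply: (big_morph (fun v => hinner L v w)) => [u v|];
  rewrite ?hinnerDl ?hinner0l.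
Qed.

Lemma hinner_sumr M (I : Type) (r : seq I) (P : pred I) (F : I -> 'M[R]_M)
    (v : 'M[R]_M) :
  hinner L v (\sum_(i <- r | P i) F i) = \sum_(i <- r | P i) hinner L v (F i).
Proof. by rewrite hinnerC hinner_suml; under eq_bigr do rewrite hinnerC. Qed.

Lemma ler_hinner M (v w v' w' : 'M[R]_M) :
  (forall a b, v a b * w a b <= v' a b * w' a b) ->
  hinner L v w <= hinner L v' w'.
Proof.
move=> le; rewrite ler_wpM2l ?sqr_ge0 // ler_sum // => a _.
by rewrite ler_sum.
Qed.

(** Used to move a pointwise factor from one argument of the inner product to the other. *)
Lemma hinner_pw M (v w v' w' : 'M[R]_M) :
  (forall a b, v a b * w a b = v' a b * w' a b) ->
  hinner L v w = hinner L v' w'.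
Proof.
by move=> e; apply/le_anti/andP; split; apply: ler_hinner => a b; rewrite e.
Qed.

Lemma hinner_ge0 M (v : 'M[R]_M) : 0 <= hinner L v v.
Proof.
rewrite -(hinner0l (0 : 'M[R]_M)); apply: ler_hinner => a b.
by rewrite mxE mul0r -expr2 sqr_ge0.
Qed.

(** The cross terms cancel by symmetry of [T]; this is why evaluating the linear part at the
    midpoint gives an exact telescoping difference. *)
Lemma hinner_halfsum M (v w : 'M[R]_M) (T : 'M[R]_M -> 'M[R]_M) :
  (forall x y, hinner L x (T y) = hinner L (T x) y) ->
  hinner L (v - w) (T (2^-1 *: (v + w))) =
  2^-1 * (hinner L v (T v) - hinner L w (T w)).
Proof.
move=> TC; rewrite hinnerDl hinnerNl !TC !hinnerZr !hinnerDr.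
by rewrite (hinnerC (T w) v) TC; lra.
Qed.

Lemma sqr_hnorm M (v : 'M[R]_M) : hnorm L v ^+ 2 = hinner L v v.
Proof. by rewrite sqr_sqrtr // hinner_ge0. Qed.

Lemma hinner_const M (c : R) : (0 < M)%N ->
  hinner L (const_mx c : 'M[R]_M) (const_mx c) = c ^+ 2 * L ^+ 2.
Proof. by move=> M0; rewrite -sqr_hnorm hnorm_const. Qed.

Lemma hinner_le_sup M (v : 'M[R]_M) (B : R) : (0 < M)%N ->
  (forall a b, `|v a b| <= B) -> hinner L v v <= B ^+ 2 * L ^+ 2.
Proof.
move=> M0 vB; rewrite -(hinner_const B M0); apply: ler_hinner => a b.
rewrite mxE -!expr2 -(real_normK (num_real (v a b))).
by rewrite lerXn2r ?nnegrE ?(le_trans _ (vB a b)) ?normr_ge0.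
Qed.

End Inner.

(** * Parseval's identity and Fourier multipliers *)

Section Fourier.
Variables (R : realType) (L : R).
Hypothesis hL : 0 < L.

(** The real part of one coefficient times the conjugate of the other, split so that real quadratic
    forms can act on real and imaginary parts separately. *)
Definition dft_dot M (v w : 'M[R]_M) (p q : 'I_M) : R :=
  complex.Re (dft L v p q) * complex.Re (dft L w p q) +
  complex.Im (dft L v p q) * complex.Im (dft L w p q).

(** Expanding [v] in modes and exchanging sums leaves the conjugate coefficients of [w]; the factor
    is h^2 M^2 = L^2. *)
Lemma parseval M (v w : 'M[R]_M) :
  hinner L v w = L ^+ 2 * \sum_(p < M) \sum_(q < M) dft_dot v w p q.
Proof.
case: (posnP M) => [M0|M0].
  by subst M; rewrite /hinner !big_ord0 !mulr0.
have MR0 : (M%:R : R) != 0 by rewrite pnatr_eq0 -lt0n.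
have MC0 : (M%:R : R[i]) != 0 by rewrite pnatr_eq0 -lt0n.
have E : (\sum_(a < M) \sum_(b < M) v a b * w a b)%:C =
    (M%:R ^+ 2) * \sum_(p < M) \sum_(q < M) dft L v p q * (dft L w p q)^*%C.
  rewrite rmorph_sum /=.
  under eq_bigr => a _ do rewrite rmorph_sum /=.
  under eq_bigr => a _ do under eq_bigr => b _ do
    rewrite rmorphM /= (dft_expansion v a b hL) /fsynth big_distrl /=.
  under eq_bigr => a _ do under eq_bigr => b _ do under eq_bigr => p _ do
    rewrite big_distrl /=.
  under eq_bigr => a _ do rewrite exchange_big /=.
  rewrite exchange_big /= big_distrr; apply: eq_bigr => p _ /=.
  under eq_bigr => a _ do rewrite exchange_big /=.
  rewrite exchange_big /= big_distrr; apply: eq_bigr => q _ /=.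
  rewrite [dft L w p q]/dft conjcM -natrX conjc_inv conjc_nat conj_sum.
  rewrite mulrCA mulVKf; last by rewrite natrX expf_neq0.
  rewrite big_distrr; apply: eq_bigr => a _ /=.
  rewrite conj_sum big_distrr; apply: eq_bigr => b _ /=.
  by rewrite conjcM conjc_real conjcK mulrA mulrAC.
have ReD : {morph (@complex.Re R) : x y / x + y} by case=> ? ? [].
have Re0 : complex.Re (0 : R[i]) = 0 by [].
have E' : \sum_(a < M) \sum_(b < M) v a b * w a b =
    M%:R ^+ 2 * \sum_(p < M) \sum_(q < M) dft_dot v w p q.
  move/(congr1 (@complex.Re R)): E => /= ->.
  rewrite -(rmorph_nat (real_complex R)) -rmorphXn /=.
  set S := (X in complex.Re (_ * X)).
  rewrite (_ : \sum_(p < M) _ = complex.Re S); first by case: S => x y /=; ring.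
  rewrite /S (big_morph _ ReD Re0); apply: eq_bigr => p _.
  rewrite (big_morph _ ReD Re0); apply: eq_bigr => q _.
  by rewrite /dft_dot; case: dft => x y; case: dft => x' y' /=; ring.
by rewrite /hinner E' /hstep; field.
Qed.

Lemma hinner_fmult M (sg : int -> int -> R) (v w : 'M[R]_M) :
  ~~ odd M -> even_sym sg ->
  hinner L v (fmult L sg w) =
  L ^+ 2 * \sum_(p < M) \sum_(q < M) sg (freq p) (freq q) * dft_dot v w p q.
Proof.
move=> eM ev; rewrite parseval; congr (_ * _).
apply: eq_bigr => p _; apply: eq_bigr => q _; rewrite /dft_dot dft_fmult //.
by case: (dft L w p q) => x y /=; ring.
Qed.

Lemma hinner_fmultC M (sg : int -> int -> R) (v w : 'M[R]_M) :
  ~~ odd M -> even_sym sg ->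
  hinner L v (fmult L sg w) = hinner L (fmult L sg v) w.
Proof.
move=> eM ev; rewrite [RHS]hinnerC !hinner_fmult //; congr (_ * _).
apply: eq_bigr => p _; apply: eq_bigr => q _; congr (_ * _).
by rewrite /dft_dot mulrC [X in _ + X]mulrC.
Qed.

Lemma fmult_const M (sg : int -> int -> R) (c : R) :
  (0 < M)%N -> ~~ odd M ->
  fmult L sg (const_mx c : 'M[R]_M) = sg 0 0 *: const_mx c.
Proof.
move=> M0 eM.
have hM : (M./2 < M)%N by have := odd_double_half M; rewrite (negPf eM); lia.
(* Frequencies are shifted by M/2, so the zero frequency has index M/2; a constant has no other
   coefficient. *)
pose o : 'I_M := Ordinal hM.
have fo : freq o = 0 by rewrite /freq subrr.
have Se (F : 'I_M -> 'I_M -> R[i]) a b :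
    fsynth L (fun p q => F p q * (if (p == o) && (q == o) then c%:C else 0)) a b =
    F o o * c%:C.
  rewrite /fsynth (bigD1 o) //= (bigD1 o) //= eqxx /=.
  rewrite !big1 ?addr0 => [|p po|q qo].
  - by rewrite fo /fmode !mul0r addr0 mulr0 cexpi0 mulr1.
  - by rewrite big1 // => q _; rewrite (negPf po) mulr0 mul0r.
  - by rewrite (negPf qo) mulr0 mul0r.
have dE p q : dft L (const_mx c : 'M[R]_M) p q = if (p == o) && (q == o) then c%:C else 0.
  symmetry.
  apply: (dft_unique
    (c := fun p q => if (p == o) && (q == o) then c%:C else 0)) => // a b.
  rewrite mxE -[LHS]mul1r -(Se (fun _ _ => 1) a b) /fsynth.
  by apply: eq_bigr => p' _; apply: eq_bigr => q' _; rewrite mul1r.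
apply/matrixP => a b; rewrite !mxE.
rewrite (_ : fsynth _ _ _ _ = (sg 0 0)%:C * c%:C) ?ReZ //.
  by rewrite /= mul0r subr0.
rewrite -[in RHS]fo -(Se (fun p q => (sg (freq p) (freq q))%:C) a b).
by apply: eq_bigr => p _; apply: eq_bigr => q _; rewrite dE.
Qed.

Lemma Ilap_sym M (v w : 'M[R]_M) : ~~ odd M ->
  hinner L v (Ilap L w) = hinner L (Ilap L v) w.
Proof.
move=> eM; rewrite !IlapE // hinner_fmultC // => m n.
by rewrite !(lap_sym_even L m n).1 !(lap_sym_even L m n).2.
Qed.

End Fourier.

(** * The discrete Sobolev inequality, uniform in [M] *)

Lemma inv_sqr1_le (R : realFieldType) (k : nat) :
  (1 + k%:R ^+ 2)^-1 <= 3 * (k.+1%:R^-1 - k.+2%:R^-1) :> R.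
Proof.
have k0 : (0 : R) <= k%:R by [].
(* This is the numerator of the difference of the two sides; it is nonnegative because no natural
   number lies strictly between 1/2 and 1. *)
have k1 : 0 <= (2 * k%:R - 1) * (k%:R - 1) :> R.
  case: k k0 => [|k] k0; first by rewrite mulr0 !sub0r mulrNN mulr1.
  by rewrite -natr1 in k0 *; have := ler0n R k; nra.
rewrite -subr_ge0 -[k.+2%:R]natr1 -[k.+1%:R]natr1.
have -> : 3 * ((k%:R + 1)^-1 - (k%:R + 1 + 1)^-1) - (1 + k%:R ^+ 2)^-1 =
    (2 * k%:R - 1) * (k%:R - 1) / ((k%:R + 1) * (k%:R + 1 + 1) * (1 + k%:R ^+ 2)) :> R.
  by field; rewrite !lt0r_neq0; nra.
by rewrite divr_ge0 // !mulr_ge0; nra.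
Qed.

Lemma sum_inv_sqr1 (R : realFieldType) (N : nat) :
  \sum_(k < N) (1 + k%:R ^+ 2)^-1 <= 3 :> R.
Proof.
have : \sum_(k < N) (1 + k%:R ^+ 2)^-1 <= 3 * (1 - N.+1%:R^-1) :> R.
  elim: N => [|N IH]; first by rewrite big_ord0 invr1 subrr mulr0.
  rewrite big_ord_recr /=; have := inv_sqr1_le R N.
  move: IH; set s := \sum_(i < N) _; set t := (1 + _)^-1.
  by move: s t (N.+1%:R^-1) (N.+2%:R^-1) => s t x y; lra.
have : 0 <= N.+1%:R^-1 :> R by rewrite invr_ge0.
by move: (N.+1%:R^-1) => x; lra.
Qed.

Lemma sum_inv_freq (R : realFieldType) (M : nat) : ~~ odd M ->
  \sum_(p < M) (1 + (freq p)%:~R ^+ 2)^-1 <= 6 :> R.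
Proof.
move=> eM; have hM := odd_double_half M; rewrite (negPf eM) add0n in hM.
rewrite (_ : 6 = 3 + 3); last by ring.
rewrite -(big_mkord xpredT (fun p => (1 + (p%:Z - (M./2)%:Z)%:~R ^+ 2)^-1)).
rewrite (big_cat_nat (n := M./2)) //=; last by lia.
apply: lerD.
  (* Reversed, the lower half of the indices runs through the frequencies -(i+1), whose terms are at
     most those of i. *)
  rewrite big_nat_rev /= add0n big_mkord.
  apply: le_trans (sum_inv_sqr1 R M./2).
  apply: ler_sum => i _.
  rewrite lef_pV2 ?posrE ?ltr_pwDl ?sqr_ge0 // lerD2l.
  rewrite (_ : _%:~R = - (i.+1%:R : R)); last first.
    rewrite -[i.+1%:R]/((i.+1%:Z)%:~R) -rmorphN; congr _%:~R.
    by have := ltn_ord i; lia.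
  by rewrite sqrrN lerXn2r ?nnegrE // ler_nat.
rewrite -{1}[M./2]add0n big_addn big_mkord.
apply: le_trans (sum_inv_sqr1 R (M - M./2)).
by apply: ler_sum => i _; rewrite PoszD addrK.
Qed.

Lemma sum_inv_nu (R : realType) (L : R) (M : nat) : 0 < L -> ~~ odd M ->
  \sum_(p < M) (1 + nu L ^+ 2 * (freq p)%:~R ^+ 2)^-1 <=
    (1 + (nu L ^+ 2)^-1) * 6.
Proof.
move=> L0 eM.
have n0 : 0 < nu L ^+ 2.
  by rewrite exprn_even_gt0 //= /nu !mulf_neq0 ?invr_neq0 ?gt_eqF ?pi_gt0.
move: (nu L ^+ 2) n0 => c c0; have ci0 : 0 < c^-1 by rewrite invr_gt0.
apply: (le_trans _ (ler_wpM2l _ (sum_inv_freq R eM))); last by lra.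
rewrite big_distrr; apply: ler_sum => p _ /=.
have := sqr_ge0 ((freq p)%:~R : R); move: (_ ^+ 2) => x x0.
rewrite -subr_ge0.
have -> : (1 + c^-1) / (1 + x) - (1 + c * x)^-1 =
  (c * c * x + 1) / (c * (1 + x) * (1 + c * x)).
  by field; rewrite !lt0r_neq0; nra.
by rewrite divr_ge0 // ?mulr_ge0; nra.
Qed.

(** A squared discrete H^2 norm; its Fourier symbol is [Lkap_sym L 1]. *)
Definition h2sq (R : realType) (L : R) M (v : 'M[R]_M) : R :=
  hinner L v v + hinner L (Ilap L v) (Ilap L v).

(** Bounds the sum over all modes of the inverse of [Lkap_sym L 1], for every even [M]. *)
Definition sobolev_const (R : realType) (L : R) : R :=
  5 * ((1 + (nu L ^+ 2)^-1) * 6) ^+ 2.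

Definition sup_of_h2 (R : realType) (L q : R) : R :=
  2^-1 * (q / L ^+ 2 + sobolev_const L).

Lemma Lkap_sym_even (R : realType) (L kap : R) : even_sym (Lkap_sym L kap).
Proof.
move=> m n.
by rewrite /Lkap_sym !(lap_sym_even L m n).1 !(lap_sym_even L m n).2.
Qed.

Lemma h2sqE (R : realType) (L : R) M (v : 'M[R]_M) : 0 < L -> ~~ odd M ->
  h2sq L v = L ^+ 2 * \sum_(p < M) \sum_(q < M)
    Lkap_sym L 1 (freq p) (freq q) * dft_dot L v v p q.
Proof.
move=> L0 eM; rewrite -hinner_fmult //; last exact: Lkap_sym_even.
by rewrite -LkapE // hinnerDr scale1r Ilap_sym // addrC.
Qed.

Lemma h2sq_ge0 (R : realType) (L : R) M (v : 'M[R]_M) : 0 <= h2sq L v.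
Proof. by rewrite addr_ge0 ?hinner_ge0. Qed.

(** The left side is the real part of (x + iy)(c + is), at most |x + iy|; AM-GM with weight [w] does
    the rest. The sign r = 1 or -1 handles the absolute value, and the gap is an explicit sum of
    squares. *)
Lemma wave_amgm (R : realFieldType) (w x y c s : R) : 0 < w ->
  c ^+ 2 + s ^+ 2 = 1 ->
  `|x * c - y * s| <= 2^-1 * (w * (x * x + y * y) + w^-1).
Proof.
move=> w0 cs1.
have E (r : R) : r ^+ 2 = 1 ->
    2^-1 * (w * (x * x + y * y) + w^-1) - r * (x * c - y * s) =
    ((w * x - r * c) ^+ 2 + (w * y + r * s) ^+ 2) / (2 * w).
  move=> r1; apply/eqP; rewrite -subr_eq0.
  rewrite (_ : _ - _ = (1 - r ^+ 2 * (c ^+ 2 + s ^+ 2)) / (2 * w)).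
    by rewrite r1 cs1 mulr1 subrr mul0r.
  by field; rewrite gt_eqF.
have P (r : R) : r ^+ 2 = 1 ->
    r * (x * c - y * s) <= 2^-1 * (w * (x * x + y * y) + w^-1).
  by move=> /E e; rewrite -subr_ge0 e divr_ge0 ?addr_ge0 ?sqr_ge0 // mulr_ge0 ?ltW.
have := P 1 (expr1n _ _); have := P (-1) (sqrr_sign _ 1).
by rewrite ler_norml; lra.
Qed.

(* 5 ((1 - x)^2 + 1) - (1 + x)^2 = (2 x - 3)^2 with x = nu^2 (m^2 + n^2), and
   (1 + x)^2 dominates the product of the two one-dimensional weights. *)
Lemma inv_Lkap_sym1 (R : realType) (L : R) (m n : int) :
  (Lkap_sym L 1 m n)^-1 <=
  5 * ((1 + nu L ^+ 2 * m%:~R ^+ 2)^-1 * (1 + nu L ^+ 2 * n%:~R ^+ 2)^-1).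
Proof.
rewrite /Lkap_sym /lap_sym.
have : 0 <= nu L ^+ 2 * (m%:~R : R) ^+ 2 by rewrite mulr_ge0 ?sqr_ge0.
have : 0 <= nu L ^+ 2 * (n%:~R : R) ^+ 2 by rewrite mulr_ge0 ?sqr_ge0.
rewrite mulrDr; move: (_ * _) (_ * _) => y x y0 x0.
rewrite -invfM -[5]invrK -invfM lef_pV2 ?posrE; last 2 first.
- by have := sqr_ge0 (1 - (x + y)); lra.
- by rewrite !mulr_gt0 ?invr_gt0 //; lra.
by have := sqr_ge0 (2 * (x + y) - 3); nra.
Qed.

(** Fourier inversion with [wave_amgm] in each mode, the weight being the H^2 symbol: the weighted
    squares add up to [h2sq] divided by L^2, the inverse weights to at most [sobolev_const]. *)
Lemma sup_le_h2 (R : realType) (L : R) M (v : 'M[R]_M) (q : R) a b :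
  0 < L -> ~~ odd M -> h2sq L v <= q -> `|v a b| <= sup_of_h2 L q.
Proof.
move=> L0 eM vq.
have L20 : 0 < L ^+ 2 by rewrite exprn_gt0.
pose w p q := Lkap_sym L 1 (@freq M p) (@freq M q).
have w0 p r : 0 < w p r.
  by rewrite /w /Lkap_sym; have := sqr_ge0 (1 + lap_sym L (freq p) (freq r)); lra.
have Wle : \sum_(p < M) \sum_(r < M) (w p r)^-1 <= sobolev_const L.
  rewrite /sobolev_const.
  pose S : R := \sum_(p < M) (1 + nu L ^+ 2 * (freq p)%:~R ^+ 2)^-1.
  have SK : S <= _ := sum_inv_nu L0 eM.
  have S0 : 0 <= S.
    by rewrite /S; apply: sumr_ge0 => p _; rewrite invr_ge0 addr_ge0 // mulr_ge0 ?sqr_ge0.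
  apply: (@le_trans _ _ (5 * S ^+ 2)); last first.
    by rewrite ler_pM2l // lerXn2r ?nnegrE // (le_trans S0).
  rewrite expr2 {1}/S big_distrl big_distrr; apply: ler_sum => p _ /=.
  by rewrite /S big_distrr big_distrr; apply: ler_sum => r _; exact: inv_Lkap_sym1.
have vE : v a b = \sum_(p < M) \sum_(r < M)
    complex.Re (dft L v p r * fmode L (freq p) (freq r) (gcoord L a) (gcoord L b)).
  have ReD : {morph (@complex.Re R) : x y / x + y} by case=> ? ? [].
  have Re0 : complex.Re (0 : R[i]) = 0 by [].
  have := dft_expansion v a b L0 => /(congr1 (@complex.Re R)) /= ->.
  rewrite /fsynth (big_morph _ ReD Re0); apply: eq_bigr => p _.
  by rewrite (big_morph _ ReD Re0).
apply: (@le_trans _ _ (2^-1 * (\sum_(p < M) \sum_(r < M) w p r * dft_dot L v v p r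
    + \sum_(p < M) \sum_(r < M) (w p r)^-1))).
  rewrite vE -big_split big_distrr.
  apply: (le_trans (ler_norm_sum _ _ _)); apply: ler_sum => p _ /=.
  rewrite -big_split big_distrr.
  apply: (le_trans (ler_norm_sum _ _ _)); apply: ler_sum => r _ /=.
  rewrite /dft_dot /fmode /cexpi; case: dft => x y /=.
  by apply: wave_amgm => //; exact: cos2Dsin2.
rewrite ler_pM2l ?invr_gt0 // lerD // ler_pdivlMr // mulrC.
by rewrite -h2sqE.
Qed.

(** * Lower triangular matrices with positive definite symmetric part *)

Lemma quad_sympart (R : realType) (s : nat) (A : 'M[R]_s) (y : 'cV[R]_s) :
  (y^T *m sympart A *m y) 0 0 = \sum_i \sum_j A i j * (y i 0 * y j 0).
Proof.
have E (B : 'M[R]_s) :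
    (y^T *m B *m y) 0 0 = \sum_i \sum_j B i j * (y i 0 * y j 0).
  rewrite mxE exchange_big; apply: eq_bigr => j _ /=.
  rewrite mxE big_distrl; apply: eq_bigr => i _ /=.
  by rewrite mxE; ring.
rewrite /sympart -scalemxAr -scalemxAl mxE mulmxDr mulmxDl mxE !E.
rewrite [X in _ + X]exchange_big /= -big_split big_distrr; apply: eq_bigr => i _ /=.
rewrite -big_split big_distrr; apply: eq_bigr => j _ /=.
by rewrite [_^T _ _]mxE; field.
Qed.

Section LowerTriangular.
Variables (R : realType) (s : nat) (A : 'M[R]_s).
Hypothesis Alow : forall i j : 'I_s, (i < j)%N -> A i j = 0.
Hypothesis Apos : posdef (sympart A).

Lemma lower_sum (i : 'I_s) (x : 'I_s -> R) :
  \sum_(j < s | (j <= i)%N) A i j * x j = \sum_j A i j * x j.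
Proof.
rewrite [LHS]big_mkcond; apply: eq_bigr => j _.
by case: leqP => // ij; rewrite Alow // mul0r.
Qed.

Lemma posdef_leading_ge0 (k : nat) (x : 'I_s -> R) :
  0 <= \sum_(i < s | (i < k)%N) \sum_(j < s | (j <= i)%N) A i j * (x i * x j).
Proof.
(* Padding with zeros turns the form of the leading block into that of the whole matrix. *)
pose y : 'cV[R]_s := \col_i (if (i < k)%N then x i else 0).
rewrite (_ : \sum_(i < s | _) _ = (y^T *m sympart A *m y) 0 0).
  have [->|/Apos/ltW //] := eqVneq y 0.
  by rewrite mulmx0 mxE.
rewrite quad_sympart big_mkcond; apply: eq_bigr => i _.
rewrite [y i 0]mxE; case: ltnP => ik; last first.
  by rewrite big1 // => j _; rewrite mul0r mulr0.
rewrite [LHS]big_mkcond; apply: eq_bigr => j _; rewrite mxE.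
case: (leqP j i) => ij; first by rewrite (leq_ltn_trans ij ik).
by rewrite Alow // mul0r.
Qed.

(** A kernel vector annihilates the quadratic form. This will force the means of the stage
    differences to vanish. *)
Lemma posdef_lower_inj (x : 'I_s -> R) :
  (forall i : 'I_s, \sum_(j < s | (j <= i)%N) A i j * x j = 0) ->
  forall i, x i = 0.
Proof.
move=> Ax0; pose y : 'cV[R]_s := \col_i x i.
suff y0 : y = 0 by move=> i; have := congr1 (fun z : 'cV[R]_s => z i 0) y0; rewrite !mxE.
have [//|/Apos] := eqVneq y 0; rewrite quad_sympart big1 ?ltxx // => i _.
transitivity (x i * \sum_j A i j * x j); last by rewrite -lower_sum Ax0 mulr0.
by rewrite big_distrr; apply: eq_bigr => j _; rewrite !mxE mulrCA.
Qed.

End LowerTriangular.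

(** * The mobility, its inverse, and the sign of the tested stage sum *)

Section Mobility.
Variables (R : realType) (L : R).
Hypothesis hL : 0 < L.

Definition Mhinv_sym (mob : mobility) (m n : int) : R :=
  match mob with
  | SH => -1
  | PFC => if (m == 0) && (n == 0) then 0
           else - (nu L ^+ 2 * (m%:~R ^+ 2 + n%:~R ^+ 2))^-1
  end.

Lemma Mhinv_sym_even mob : even_sym (Mhinv_sym mob).
Proof. by case: mob => m n //=; rewrite !oppr_eq0 !rmorphN !sqrrN. Qed.

Lemma Mhinv_sym_le0 mob m n : Mhinv_sym mob m n <= 0.
Proof.
case: mob => /=; first by rewrite oppr_le0.
case: ifP => // _.
by rewrite oppr_le0 invr_ge0 mulr_ge0 ?addr_ge0 ?sqr_ge0.
Qed.

Lemma MhinvE mob M (v : 'M[R]_M) : Mhinv L mob v = fmult L (Mhinv_sym mob) v.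
Proof.
case: mob => //=; rewrite -[in LHS](fmult1 v hL) -scaleN1r -fmultZ.
by congr fmult; apply/funext => m; apply/funext => n; rewrite mulr1.
Qed.

Lemma Mh_sym_even mob : even_sym (Mh_sym L mob).
Proof. by case: mob => //=; exact: lap_sym_even. Qed.

Lemma Mh_sym_le0 mob m n : Mh_sym L mob m n <= 0.
Proof.
case: mob => /=; first by rewrite oppr_le0.
by rewrite /lap_sym oppr_le0 mulr_ge0 ?addr_ge0 ?sqr_ge0.
Qed.

Lemma MhC mob M (v w : 'M[R]_M) : ~~ odd M ->
  hinner L v (Mh L mob w) = hinner L (Mh L mob v) w.
Proof.
case: mob => /= eM; first by rewrite hinnerNl hinnerNr.
by rewrite /lap hinner_fmultC //; exact: lap_sym_even.
Qed.

Lemma hinner_lap_const M (v : 'M[R]_M) : (0 < M)%N -> ~~ odd M ->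
  hinner L (lap L v) (const_mx 1) = 0.
Proof.
move=> M0 eM; rewrite /lap -hinner_fmultC //; last exact: lap_sym_even.
by rewrite fmult_const // /lap_sym expr0n addr0 mulr0 oppr0 scale0r hinnerC hinner0l.
Qed.

Lemma hinner_Mhinv_Mh mob M (v w : 'M[R]_M) : ~~ odd M ->
  (mob = PFC -> hinner L v (const_mx 1) = 0) ->
  hinner L (Mhinv L mob v) (Mh L mob w) = hinner L v w.
Proof.
move=> eM; case: mob => v0; last by rewrite MhC // Mh_Mhinv // v0.
by rewrite /= hinnerNl hinnerNr opprK.
Qed.

Variables (kap tau : R) (mob : mobility) (s : nat) (D : R -> 'M[R]_s).
Hypothesis (kap0 : 0 <= kap) (tau0 : 0 < tau).
Hypothesis hDlow : forall z : R, z <= 0 ->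
  forall i j : 'I_s, (i < j)%N -> D z i j = 0.
Hypothesis hDpos : forall z : R, z <= 0 -> posdef (sympart (D z)).

Definition ML_sym (m n : int) : R :=
  tau * (Mh_sym L mob m n * Lkap_sym L kap m n).

Lemma ML_sym_le0 m n : ML_sym m n <= 0.
Proof.
rewrite /ML_sym pmulr_rle0 // mulr_le0_ge0 ?Mh_sym_le0 //.
by rewrite /Lkap_sym addr_ge0 ?sqr_ge0.
Qed.

Lemma ML_sym_even (g : R -> R) : even_sym (fun m n => g (ML_sym m n)).
Proof.
move=> m n; rewrite /ML_sym.
rewrite !(Mh_sym_even mob m n).1 !(Mh_sym_even mob m n).2.
by rewrite !(Lkap_sym_even L kap m n).1 !(Lkap_sym_even L kap m n).2.
Qed.

Variables (M : nat) (u : nat -> nat -> 'M[R]_M).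
Hypothesis eM : ~~ odd M.

(* Mode by mode, the sum is the quadratic form of the leading block of D,
   weighted by the nonpositive eigenvalue of Mhinv. *)
Lemma stage_sum_le0 n k :
  \sum_(i < s | (i < k)%N)
    hinner L (Mhinv L mob (dtau u n i.+2)) (dsum L kap tau mob D u n i) <= 0.
Proof.
pose d (i : 'I_s) := dtau u n i.+2.
pose X (p q : 'I_M) := \sum_(i < s | (i < k)%N) \sum_(j < s | (j <= i)%N)
  D (ML_sym (freq p) (freq q)) i j * dft_dot L (d i) (d j) p q.
have X0 p q : 0 <= X p q.
  rewrite /X /dft_dot.
  under eq_bigr => i _ do (under eq_bigr => j _ do rewrite mulrDr; rewrite big_split /=).
  have z0 := ML_sym_le0 (freq p) (freq q).
  (* The real and imaginary parts of the coefficients each give a real quadratic form of the leading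
     block. *)
  rewrite big_split addr_ge0 //.
    exact: (posdef_leading_ge0 (hDlow z0) (hDpos z0) k
      (fun i => complex.Re (dft L (d i) p q))).
  exact: (posdef_leading_ge0 (hDlow z0) (hDpos z0) k
    (fun i => complex.Im (dft L (d i) p q))).
rewrite (_ : \sum_(i < s | _) _ = L ^+ 2 * \sum_(p < M) \sum_(q < M)
    Mhinv_sym mob (freq p) (freq q) * X p q).
  rewrite mulr_ge0_le0 ?sqr_ge0 //; apply: sumr_le0 => p _; apply: sumr_le0 => q _.
  by rewrite mulr_le0_ge0 ?Mhinv_sym_le0.
transitivity (\sum_(i < s | (i < k)%N) \sum_(j < s | (j <= i)%N) L ^+ 2 *
    \sum_(p < M) \sum_(q < M) Mhinv_sym mob (freq p) (freq q) *
      (D (ML_sym (freq p) (freq q)) i j * dft_dot L (d i) (d j) p q)).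
  apply: eq_bigr => i _; rewrite /dsum hinner_sumr; apply: eq_bigr => j _.
  have ev := ML_sym_even (fun z => D z i j).
  have ev2 := Mhinv_sym_even mob.
  rewrite MhinvE -hinner_fmultC // /funML fmult_comp // hinner_fmult //.
    congr (_ * _); apply: eq_bigr => p _; apply: eq_bigr => q _.
    exact/esym/mulrA.
  by move=> m' n'; have [-> ->] := ev m' n'; have [-> ->] := ev2 m' n'.
under eq_bigr => i _ do rewrite -big_distrr /= exchange_big /=.
rewrite -big_distrr /= exchange_big; congr (_ * _); apply: eq_bigr => p _ /=.
under eq_bigr => i _ do rewrite exchange_big /=.
rewrite exchange_big; apply: eq_bigr => q _ /=.
rewrite /X big_distrr; apply: eq_bigr => i _ /=.
by rewrite big_distrr.
Qed.

End Mobility.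

(** * Consequences of testing the scheme *)

Section Scheme.
Variables (R : realType) (L eps kap tau : R) (mob : mobility) (s : nat).
Variables (D : R -> 'M[R]_s) (M : nat) (phi0 : 'M[R]_M).
Variable u : nat -> nat -> 'M[R]_M.
Hypotheses (hL : 0 < L) (eps0 : 0 < eps) (eps1 : eps < 1).
Hypotheses (kap0 : 0 <= kap) (tau0 : 0 < tau).
Hypothesis hDlow : forall z : R, z <= 0 ->
  forall i j : 'I_s, (i < j)%N -> D z i j = 0.
Hypothesis hDpos : forall z : R, z <= 0 -> posdef (sympart (D z)).
Hypotheses (M0 : (0 < M)%N) (eM : ~~ odd M).
Hypothesis uP : is_RK_solution L eps kap tau mob D phi0 u.

(** The right side of the scheme is a discrete Laplacian and has zero mean. On means, each operator
    d_ij acts as its value at the eigenvalue of mode (0, 0), so the means solve a homogeneous system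
    with an injective matrix. *)
Lemma dtau_mean0 n (i : 'I_s) : (1 <= n)%N -> mob = PFC ->
  hinner L (dtau u n i.+2) (const_mx 1) = 0.
Proof.
move=> n1 mobE; have z0 := ML_sym_le0 L mob kap0 tau0 0 0.
apply: (posdef_lower_inj (hDlow z0) (hDpos z0)
  (x := fun i : 'I_s => hinner L (dtau u n i.+2) (const_mx 1))) => {}i.
case: uP => _ _ /(_ n i n1) /(congr1 (fun v => hinner L v (const_mx 1))).
rewrite {2}mobE hinner_lap_const // hinnerZl => /eqP.
rewrite mulf_eq0 invr_eq0 gt_eqF //= => /eqP => e; rewrite -[RHS]e /dsum.
rewrite hinner_suml; apply: eq_bigr => j _.
have ev := ML_sym_even L kap tau mob (fun z => D z i j).
by rewrite /funML -hinner_fmultC // fmult_const // hinnerZr.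
Qed.

(** With d = b - a, the implicit kap-term at (a + b)/2 minus the explicit one at a is kap d/2, hence
    the term kap/2 |d|^2. *)
Lemma stage_identity n (i : 'I_s) : (1 <= n)%N ->
  tau^-1 * hinner L (Mhinv L mob (dtau u n i.+2)) (dsum L kap tau mob D u n i) =
  2^-1 * (hinner L (Ilap L (u n i.+2)) (Ilap L (u n i.+2))
          - hinner L (Ilap L (u n i.+1)) (Ilap L (u n i.+1)))
  + kap / 2 * hinner L (dtau u n i.+2) (dtau u n i.+2)
  - hinner L (dtau u n i.+2) (map_mx (ff eps) (u n i.+1)).
Proof.
move=> n1; rewrite -(hinnerZr L tau^-1); case: uP => _ _ /(_ n i n1) ->.
rewrite hinner_Mhinv_Mh //; last exact: dtau_mean0.
rewrite /dtau /=; move: (u n i.+2) (u n i.+1) => b a.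
rewrite /Lkap (_ : map_mx (fkap eps kap) a = kap *: a + map_mx (ff eps) a); last first.
  by apply/matrixP => p q; rewrite !mxE.
rewrite hinnerDr hinnerNr 2!(hinnerDr L (b - a)).
rewrite (hinner_halfsum _ _ (T := fun v => Ilap L (Ilap L v))); last first.
  by move=> x y; rewrite !Ilap_sym.
rewrite !Ilap_sym // !hinnerZr !hinnerDl !hinnerDr !hinnerNl !hinnerNr.
by rewrite !hinnerZr (hinnerC L a b); field.
Qed.

Lemma stage_sum_quad_le0 n k : (1 <= n)%N -> (k <= s)%N ->
  2^-1 * (hinner L (Ilap L (u n k.+1)) (Ilap L (u n k.+1))
          - hinner L (Ilap L (u n 1%N)) (Ilap L (u n 1%N)))
  + \sum_(i < k) (kap / 2 * hinner L (dtau u n i.+2) (dtau u n i.+2)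
    - hinner L (dtau u n i.+2) (map_mx (ff eps) (u n i.+1))) <= 0.
Proof.
move=> n1 ks.
have := stage_sum_le0 hL mob kap0 tau0 hDlow hDpos u eM n k.
rewrite -(pmulr_rle0 _ (_ : 0 < tau^-1)) ?invr_gt0 // big_distrr /=.
under eq_bigr => i _ do rewrite stage_identity // -addrA.
rewrite big_split /= -big_distrr /=.
pose A j := hinner L (Ilap L (u n j.+1)) (Ilap L (u n j.+1)).
rewrite -(big_ord_widen s (fun i => A i.+1 - A i)) //.
rewrite -(big_ord_widen s (fun i =>
  kap / 2 * hinner L (dtau u n i.+2) (dtau u n i.+2)
    - hinner L (dtau u n i.+2) (map_mx (ff eps) (u n i.+1)))) //.
by rewrite -(big_mkord xpredT (fun i => A i.+1 - A i)) telescope_sumr.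
Qed.

End Scheme.

(** * Pointwise estimates of the potential and the nonlinearity *)

Section Energy.
Variables (R : realType) (L eps : R).
Hypotheses (hL : 0 < L) (eps0 : 0 < eps) (eps1 : eps < 1).

Lemma FF_step (x y kap B : R) : `|x| <= B -> `|y| <= B -> 3 * B ^+ 2 <= kap ->
  FF eps y - FF eps x + (y - x) * ff eps x <= kap / 2 * (y - x) ^+ 2.
Proof.
rewrite !ler_norml /FF /ff => /andP[x1 x2] /andP[y1 y2] kB.
(* The Taylor remainder is divisible by (y - x)^2; on [-B, B] the quotient is at most 6 B^2 / 4,
   which is where 3 B^2 comes from. *)
have -> : 4^-1 * y ^+ 4 - eps / 2 * y ^+ 2 - (4^-1 * x ^+ 4 - eps / 2 * x ^+ 2)
    + (y - x) * (eps * x - x ^+ 3) =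
    (y - x) ^+ 2 * ((y ^+ 2 + 2 * y * x + 3 * x ^+ 2) / 4 - eps / 2) by field.
rewrite mulrC ler_wpM2r ?sqr_ge0 //.
have xB : 0 <= (B - x) * (B + x) by rewrite mulr_ge0 //; lra.
have yB : 0 <= (B - y) * (B + y) by rewrite mulr_ge0 //; lra.
have := sqr_ge0 (x - y); have := eps0; rewrite expr2; lra.
Qed.

Lemma energy_step M (a b : 'M[R]_M) (kap B : R) : ~~ odd M ->
  (forall p q, `|a p q| <= B) -> (forall p q, `|b p q| <= B) ->
  3 * B ^+ 2 <= kap ->
  energy L eps b - energy L eps a <=
  2^-1 * (hinner L (Ilap L b) (Ilap L b) - hinner L (Ilap L a) (Ilap L a))
  + kap / 2 * hinner L (b - a) (b - a) - hinner L (b - a) (map_mx (ff eps) a).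
Proof.
move=> eM aB bB kB; rewrite /energy !Ilap_sym //.
rewrite (_ : hinner L (b - a) (map_mx (ff eps) a) =
    hinner L (\matrix_(p, q) ((b - a) p q * ff eps (a p q))) (const_mx 1)); last first.
  by apply: hinner_pw => p q; rewrite !mxE mulr1.
set P := \matrix_(p, q) _.
suff : hinner L (map_mx (FF eps) b - map_mx (FF eps) a + P) (const_mx 1) <=
    hinner L (kap / 2 *: (b - a)) (b - a).
  by rewrite hinnerZl 2!(hinnerDl _ _ _ (const_mx 1)) (hinnerNl _ _ (const_mx 1)); lra.
apply: ler_hinner => p q; rewrite !mxE mulr1.
by rewrite -(mulrA (kap / 2)) -expr2; exact: FF_step.
Qed.

(** Pointwise, 4 F(x) + (1 + eps)^2 - 2 x^2 is the square of x^2 - (1 + eps). *)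
Lemma h2_le_energy M (v : 'M[R]_M) : (0 < M)%N -> ~~ odd M ->
  2 * h2sq L v <= 4 * energy L eps v + (1 + eps) ^+ 2 * L ^+ 2.
Proof.
move=> M0 eM; rewrite /h2sq /energy !Ilap_sym // -(hinner_const L _ M0).
suff : hinner L (2 *: v) v <=
    4 * hinner L (map_mx (FF eps) v) (const_mx 1) +
    hinner L (const_mx (1 + eps) : 'M[R]_M) (const_mx (1 + eps)) by rewrite hinnerZl; lra.
rewrite (_ : hinner L (const_mx (1 + eps)) _ =
    hinner L (const_mx ((1 + eps) ^+ 2) : 'M[R]_M) (const_mx 1)); last first.
  by apply: hinner_pw => p q; rewrite !mxE mulr1.
rewrite -hinnerZl -hinnerDl; apply: ler_hinner => p q; rewrite !mxE /FF mulr1.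
have := sqr_ge0 (v p q ^+ 2 - (1 + eps)).
have := sqr_ge0 (v p q); move: (v p q) => x; rewrite !expr2 => x0.
have : 0 <= eps * (x * x) by rewrite mulr_ge0 // ltW.
lra.
Qed.

Lemma hnorm_sum_le M (v : 'M[R]_M) : (0 < M)%N -> ~~ odd M ->
  hnorm L (Ilap L v) + hnorm L v <=
  Num.sqrt (4 * energy L eps v + hnorm L (const_mx (1 + eps) : 'M[R]_M) ^+ 2).
Proof.
move=> M0 eM; rewrite hnorm_const //.
have := h2_le_energy v M0 eM; rewrite /h2sq -!sqr_hnorm.
have : 0 <= hnorm L v by exact: sqrtr_ge0.
have : 0 <= hnorm L (Ilap L v) by exact: sqrtr_ge0.
move: (hnorm L v) (hnorm L (Ilap L v)) => x y y0 x0 le.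
rewrite -(ger0_norm (addr_ge0 y0 x0)) -sqrtr_sqr; apply: ler_wsqrtr.
apply: le_trans le; have := sqr_ge0 (x - y); nra.
Qed.

(** Since eps < 1, |f| is at most B + B^3 on [-B, B]. *)
Definition ff_of_h2 (q : R) : R :=
  (sup_of_h2 L q + sup_of_h2 L q ^+ 3) ^+ 2 * L ^+ 2.

Lemma hinner_ff_le M (v : 'M[R]_M) q : (0 < M)%N -> ~~ odd M ->
  h2sq L v <= q ->
  hinner L (map_mx (ff eps) v) (map_mx (ff eps) v) <= ff_of_h2 q.
Proof.
move=> M0 eM vq; apply: hinner_le_sup => // a b; rewrite mxE /ff.
have := sup_le_h2 a b hL eM vq; move: (v a b) (sup_of_h2 L q) => x B xB.
apply: (le_trans (ler_normB _ _)); rewrite normrM normrX.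
have x0 := normr_ge0 x.
rewrite lerD ?lerXn2r ?nnegrE ?(le_trans x0) // (gtr0_norm eps0).
by apply: le_trans xB; rewrite ler_piMl // ltW.
Qed.

Lemma hinner_young M (kap : R) (v w : 'M[R]_M) : 1 <= kap ->
  hinner L v w <= kap / 4 * hinner L v v + hinner L w w.
Proof.
move=> k1; suff : hinner L (v - w) w <= hinner L (4^-1 *: v) v.
  rewrite hinnerDl hinnerNl hinnerZl; have := hinner_ge0 L v; nra.
apply: ler_hinner => a b; rewrite !mxE.
by have := sqr_ge0 (v a b / 2 - w a b); nra.
Qed.

(** With Phi = [ff_of_h2 q], the stage balance bounds the new |(I+Lap)u|^2 by q + 2 s Phi and the
    last |d|^2 by 2 q + 4 s Phi; the new |u|^2 is then at most 2 q + 2 |d|^2, that is 6 q + 8 s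
    Phi. *)
Definition stage_growth (s : nat) (q : R) : R :=
  7 * q + (10 * s%:R) * ff_of_h2 q.

Lemma ff_of_h2_ge0 q : 0 <= ff_of_h2 q.
Proof. by rewrite mulr_ge0 ?sqr_ge0. Qed.

Lemma stage_growth_ge s q : 0 <= q -> q <= stage_growth s q.
Proof.
move=> q0; have : 0 <= 10 * s%:R * ff_of_h2 q.
  by rewrite mulr_ge0 ?ff_of_h2_ge0 // mulr_ge0 ?ler0n.
by rewrite /stage_growth; lra.
Qed.

End Energy.

(** * Bounds on the stages of one step and the energy law *)

Section Dissipation.
Variables (R : realType) (L eps kap tau : R) (mob : mobility) (s : nat).
Variables (D : R -> 'M[R]_s) (M : nat) (phi0 : 'M[R]_M).
Variable u : nat -> nat -> 'M[R]_M.
Hypotheses (hL : 0 < L) (eps0 : 0 < eps) (eps1 : eps < 1).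
Hypotheses (kap1 : 1 <= kap) (tau0 : 0 < tau).
Hypothesis hDlow : forall z : R, z <= 0 ->
  forall i j : 'I_s, (i < j)%N -> D z i j = 0.
Hypothesis hDpos : forall z : R, z <= 0 -> posdef (sympart (D z)).
Hypotheses (M0 : (0 < M)%N) (eM : ~~ odd M).
Hypothesis uP : is_RK_solution L eps kap tau mob D phi0 u.

Let kap0 : 0 <= kap := le_trans ler01 kap1.

(* The stabilization terms cancel from the quadratic balance except for
   kap/2 |dtau|^2, which absorbs <dtau, f>: hence a bound uniform in kap, tau. *)
Lemma h2sq_next_stage n k q : (1 <= n)%N -> (k < s)%N ->
  (forall j, (j <= k)%N -> h2sq L (u n j.+1) <= q) ->
  h2sq L (u n k.+2) <= stage_growth L s q.
Proof.
move=> n1 ks uq.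
have := stage_sum_quad_le0 hL kap0 tau0 hDlow hDpos M0 eM uP n1 ks.
pose d i := dtau u n i.+2; pose Phi := ff_of_h2 L q.
have Phi0 : 0 <= Phi := ff_of_h2_ge0 L q.
(* Young's inequality leaves a quarter of each |d_i|^2; only the last is kept, being the one that
   controls the new stage. *)
have low : 4^-1 * hinner L (d k) (d k) - s%:R * Phi <=
    \sum_(i < k.+1) (kap / 2 * hinner L (d i) (d i)
      - hinner L (d i) (map_mx (ff eps) (u n i.+1))).
  apply: (@le_trans _ _ (\sum_(i < k.+1) (4^-1 * hinner L (d i) (d i) - Phi))).
    rewrite big_split /= sumr_const card_ord mulNrn -[Phi *+ _]mulr_natl big_ord_recr /=.
    have : 0 <= \sum_(i < k) 4^-1 * hinner L (d i) (d i).
      by apply: sumr_ge0 => i _; rewrite mulr_ge0 ?hinner_ge0.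
    have : k.+1%:R * Phi <= s%:R * Phi by rewrite ler_wpM2r // ler_nat.
    by lra.
  apply: ler_sum => i _.
  have := hinner_young L (d i) (map_mx (ff eps) (u n i.+1)) kap1.
  have : hinner L (map_mx (ff eps) (u n i.+1)) (map_mx (ff eps) (u n i.+1)) <= Phi.
    by apply: hinner_ff_le => //; apply: uq; rewrite -ltnS.
  have : hinner L (d i) (d i) <= kap * hinner L (d i) (d i).
    by rewrite ler_peMl ?hinner_ge0.
  by lra.
have Phis : 0 <= s%:R * Phi by rewrite mulr_ge0 ?ler0n.
have := uq 0%N isT; have := uq k (leqnn k); move: low.
(* For b = [u n k.+2] and a = [u n k.+1] this is |b - 2a|^2 >= 0. *)
have : hinner L (u n k.+2) (u n k.+2) <=
    2 * hinner L (u n k.+1) (u n k.+1) + 2 * hinner L (d k) (d k).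
  rewrite /d /dtau /=; move: (u n k.+2) (u n k.+1) => b a.
  have := hinner_ge0 L (b - a - a).
  by rewrite !hinnerDl !hinnerDr !hinnerNl !hinnerNr (hinnerC L a b); lra.
rewrite /h2sq /stage_growth -/Phi.
have := hinner_ge0 L (Ilap L (u n 1%N)); have := hinner_ge0 L (u n 1%N).
have := hinner_ge0 L (Ilap L (u n k.+1)); have := hinner_ge0 L (u n k.+1).
have := hinner_ge0 L (Ilap L (u n k.+2)); have := hinner_ge0 L (d k).
move: (\sum_(i < _) _) => S; lra.
Qed.

Lemma iter_stage_growth_ge0 k q : 0 <= q -> 0 <= iter k (stage_growth L s) q.
Proof.
by move=> q0; elim: k => //= k IH; apply: (le_trans IH); exact: stage_growth_ge.
Qed.

Lemma h2sq_stages n q k : (1 <= n)%N -> h2sq L (u n 1%N) <= q -> (k <= s)%N ->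
  forall j, (j <= k)%N -> h2sq L (u n j.+1) <= iter k (stage_growth L s) q.
Proof.
move=> n1 u1; have q0 : 0 <= q := le_trans (h2sq_ge0 L _) u1.
elim: k => [|k IH] ks j; first by rewrite leqn0 => /eqP ->.
rewrite leq_eqVlt => /predU1P[->|jk].
  by apply: h2sq_next_stage => //; exact/IH/ltnW.
apply: (le_trans (IH (ltnW ks) j jk)).
by apply: stage_growth_ge; exact: iter_stage_growth_ge0.
Qed.

(** The inequality holds term by term: [energy_step] bounds each energy increment by the expression
    that [stage_identity] equates with the tested scheme. *)
Lemma energy_law n k q : (1 <= n)%N -> (k <= s)%N -> h2sq L (u n 1%N) <= q ->
  3 * sup_of_h2 L (iter s (stage_growth L s) q) ^+ 2 <= kap ->
  energy L eps (u n k.+1) - energy L eps (u n 1%N) <=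
  tau^-1 * \sum_(i < s | (i < k)%N)
    hinner L (Mhinv L mob (dtau u n i.+2)) (dsum L kap tau mob D u n i).
Proof.
move=> n1 ks u1 kB.
have uB j : (j <= s)%N -> forall a b, `|u n j.+1 a b| <=
    sup_of_h2 L (iter s (stage_growth L s) q).
  by move=> js a b; apply: sup_le_h2 => //; exact: h2sq_stages.
rewrite -(telescope_sumr (fun i => energy L eps (u n i.+1)) (leq0n k)) big_mkord.
rewrite (big_ord_widen s (fun i => energy L eps (u n i.+2) - energy L eps (u n i.+1))) //.
rewrite big_distrr; apply: ler_sum => i _ /=.
rewrite (stage_identity hL kap0 tau0 hDlow hDpos M0 eM uP) //.
by apply: (energy_step hL eps0 eM _ _ kB); apply: uB => //; exact: ltnW.
Qed.

Lemma energy_stage_le n k q : (1 <= n)%N -> (k <= s)%N -> h2sq L (u n 1%N) <= q ->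
  3 * sup_of_h2 L (iter s (stage_growth L s) q) ^+ 2 <= kap ->
  energy L eps (u n k.+1) <= energy L eps (u n 1%N).
Proof.
move=> n1 ks u1 kB; rewrite -subr_le0; apply: (le_trans (energy_law n1 ks u1 kB)).
by rewrite pmulr_rle0 ?invr_gt0 //; exact: stage_sum_le0.
Qed.

End Dissipation.

Theorem theorem1p1 (R : realType) (L eps : R) (mob : mobility) (s : nat)
    (D : R -> 'M[R]_s) (les : R)
    (hL : 0 < L) (heps0 : 0 < eps) (heps1 : eps < 1)
    (hs : (1 <= s)%N)
    (hDlow : forall z : R, z <= 0 ->
       forall i j : 'I_s, (i < j)%N -> D z i j = 0)
    (hDpos : forall z : R, z <= 0 -> posdef (sympart (D z)))
    (hles : 0 < les)
    (hDmin : forall z : R, z <= 0 -> les <= lambda_min (sympart (D z))) :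
  forall K : R, exists cf : R, 0 < cf /\
  forall kap : R, cf <= kap -> exists tau0 : R, 0 < tau0 /\
  forall (M : nat), (0 < M)%N -> ~~ odd M ->
  forall phi0 : 'M[R]_M, energy L eps phi0 <= K ->
  forall tau : R, 0 < tau -> tau <= tau0 ->
  forall u : nat -> nat -> 'M[R]_M,
    is_RK_solution L eps kap tau mob D phi0 u ->
    (forall n k : nat, (1 <= n)%N -> (1 <= k <= s)%N ->
       energy L eps (u n k.+1) - energy L eps (u n 1%N) <=
       tau^-1 * \sum_(i < s | (i < k)%N)
         hinner L (Mhinv L mob (dtau u n i.+2)) (dsum L kap tau mob D u n i))
    /\
    (forall n i : nat, (1 <= n)%N -> (1 <= i <= s)%N ->
       hnorm L (Ilap L (u n i)) + hnorm L (u n i) <=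
       Num.sqrt (4 * energy L eps phi0
                 + hnorm L (const_mx (1 + eps) : 'M[R]_M) ^+ 2)).
Proof.
(* By [h2_le_energy], [q] bounds [h2sq] of every grid function of energy at most [K]; the absolute
   value keeps it nonnegative for all [K]. *)
move=> K; pose q : R := `|4 * K| + (1 + eps) ^+ 2 * L ^+ 2.
pose B := sup_of_h2 L (iter s (stage_growth L s) q).
have B20 : 0 <= B ^+ 2 by exact: sqr_ge0.
(* 3 B^2 serves [energy_step]; the added 1 gives positivity and the bound kap >= 1 for Young's
   inequality. *)
exists (3 * B ^+ 2 + 1); split; first by lra.
move=> kap hkap; exists 1; split=> // M M0 eM phi0 hE tau tau0 _ u uP.
have kap1 : 1 <= kap by lra.
have kB : 3 * B ^+ 2 <= kap by lra.
have Eq (v : 'M[R]_M) : energy L eps v <= energy L eps phi0 -> h2sq L v <= q.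
  move=> Ev; have := h2_le_energy hL heps0 v M0 eM; have := h2sq_ge0 L v.
  by rewrite /q; have := ler_norm (4 * K); lra.
(* Every step starts below the initial energy, so the same [q] and [B] serve all steps. *)
have E1 n : (1 <= n)%N -> energy L eps (u n 1%N) <= energy L eps phi0.
  elim: n => // -[|n] IH _; first by case: uP => ->.
  have En := IH isT; apply: (le_trans _ En).
  case: (uP) => _ -> // _.
  exact: (energy_stage_le hL heps0 heps1 kap1 tau0 hDlow hDpos M0 eM uP _ _ (Eq _ En) kB).
split=> n i n1 /andP[i1 iS].
  exact: (energy_law hL heps0 heps1 kap1 tau0 hDlow hDpos M0 eM uP n1 iS
    (Eq _ (E1 n n1)) kB).
apply: (le_trans (hnorm_sum_le hL heps0 _ M0 eM)); apply: ler_wsqrtr.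
(* Stage [i.+1] is the case k = i of [energy_stage_le]; k = 0 covers the first stage. *)
rewrite lerD2r ler_pM2l //; apply: le_trans (E1 n n1); case: i i1 iS => // i _ iS.
exact: (energy_stage_le hL heps0 heps1 kap1 tau0 hDlow hDpos M0 eM uP n1
  (ltnW iS) (Eq _ (E1 n n1)) kB).
Qed.
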